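(* Let $R$ be a tolerance on a set $U$. The following are equivalent: (a) $R$ is induced by an irredundant covering of $U$. (b) The quasiordered set $(U,\lesssim_R)$ is bounded by minimal elements and $R$ equals $\approx_R$.
   Context: A tolerance on $U$ is a reflexive and symmetric binary relation on $U$; $R(x)=\{y\in U\mid x\,R\,y\}$. A covering of $U$ is a collection $\mathcal{H}$ of nonempty subsets of $U$ with $\bigcup\mathcal{H}=U$; it is irredundant if $\mathcal{H}\setminus\{X\}$ is not a covering of $U$ for any $X\in\mathcal{H}$. The tolerance induced by a covering $\mathcal{H}$ is $R_{\mathcal{H}}=\bigcup\{X^2\mid X\in\mathcal{H}\}$, where $X^2 = X\times X$. A quasiorder is a reflexive and transitive binary relation. In a quasiordered set $(U,\lesssim)$, an element $x$ is minimal if $y\lesssim x$ implies $x\lesssim y$; $(U,\lesssim)$ is bounded by minimal elements if for every $x\in U$ there is a minimal $m\in U$ with $m\lesssim x$. For a tolerance $R$ on $U$, $\lesssim_R$ is the quasiorder on $U$ defined by $x\lesssim_R y$ if and only if $R(x)\subseteq R(y)$. The relation $\approx_R$ is the product ${\gtrsim_R}\circ{\lesssim_R}$, that is, $x\approx_R y$ if and only if there exists $a\in U$ with $a\lesssim_R x$ and $a\lesssim_R y$ (equivalently, $R(a)\subseteq R(x)\cap R(y)$). *)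

(* Defs.v *)
From mathcomp Require Import all_boot.
From mathcomp Require Import classical_sets.

Set Implicit Arguments.
Unset Strict Implicit.
Unset Printing Implicit Defensive.

Local Open Scope classical_set_scope.

Section Definitions.
Context {U : Type}.
Implicit Types (R L : set (U * U)) (H : set (set U)).

Definition tolerance R :=
  (forall x, R (x, x)) /\ (forall x y, R (x, y) -> R (y, x)).

Definition covering H :=
  (forall X, H X -> X !=set0) /\ \bigcup_(X in H) X = [set: U].

Definition irredundant H := forall X, H X -> ~ covering (H `\ X).

Definition induced_tolerance H : set (U * U) := \bigcup_(X in H) (X `*` X).

Definition quasiorder L :=
  (forall x, L (x, x)) /\ (forall x y z, L (x, y) -> L (y, z) -> L (x, z)).

Definition minimal_elt L x := forall y, L (y, x) -> L (x, y).

Definition bounded_by_minimal L :=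
  forall x, exists m, minimal_elt L m /\ L (m, x).

(* R(x) is the section [xsection R x]. *)
Definition nbhd_le R : set (U * U) :=
  [set xy | xsection R xy.1 `<=` xsection R xy.2].

Lemma nbhd_le_quasiorder R : quasiorder (nbhd_le R).
Proof. by split=> [x|x y z]; [exact: subset_refl|exact: subset_trans]. Qed.

(* [B \; A] applies A first, so this is the set of pairs (x, y) such
   that, for some a, R(a) is included in R(x) and in R(y). *)
Definition nbhd_approx R : set (U * U) :=
  (nbhd_le R \; (nbhd_le R)^-1)%relation.

Lemma nbhd_approxE R x y : nbhd_approx R (x, y) <->
  exists a, nbhd_le R (a, x) /\ nbhd_le R (a, y).
Proof. by split=> [[a]|[a []]]; exists a. Qed.

End Definitions.

(* Main.v *)
Require Import Defs.
From mathcomp Require Import all_boot.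
From mathcomp Require Import boolp classical_sets.

(** Both conditions say that [R] is determined by the neighbourhoods that are
    minimal for inclusion.

    In an irredundant covering every block [X] owns a point [p] lying in no
    other block, so the neighbourhood of [p] in the induced tolerance is [X]
    itself ([xsection_private]): the blocks are themselves neighbourhoods.
    Every neighbourhood of a point of [X] contains [X], so private points are
    minimal and lie below all points of their block.  If [a] lies in [X] and
    below [z], then [p] is a neighbour of [a], hence of [z], so [z] is in [X];
    two points with a common lower bound thus share a block.

    Conversely, the covering is the collection of the neighbourhoods of minimal
    points.  When [R] is [nbhd_approx R], a minimal point lies below each of its
    neighbours ([minimal_le_neighbour]): it has a common lower bound with the
    neighbour, and minimality makes it equivalent to that bound.  Two minimal
    points that are neighbours thus have the same neighbourhood, so a minimal
    point is private to its own neighbourhood, and irredundance follows. *)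

Set Implicit Arguments.
Unset Strict Implicit.
Unset Printing Implicit Defensive.

Local Open Scope classical_set_scope.

Section IrredundantCoverings.
Context {U : Type}.
Implicit Types (R : set (U * U)) (H : set (set U)) (X : set U) (x y z m p : U).

Lemma nbhd_leP R x y :
  nbhd_le R (x, y) <-> forall z, R (x, z) -> R (y, z).
Proof.
by split=> xy z; [move/xsectionP/xy/xsectionP|move/xsectionP/xy/xsectionP].
Qed.

Lemma covering_pick H x : covering H -> exists2 X, H X & X x.
Proof.
by case=> _ cov; have : [set: U] x by []; rewrite -cov => -[X HX Xx]; exists X.
Qed.

(** Removing [X] cannot make a remaining block empty, so the only way for
    [H `\ X] not to be a covering is that it misses a point. *)
Lemma irredundant_private H X : covering H -> irredundant H -> H X ->
  exists2 p, X p & forall Y, H Y -> Y p -> Y = X.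
Proof.
move=> covH irrH HX; apply: contrapT => noP; apply: (irrH X HX).
split=> [Y [HY _]|]; first exact: covH.1.
apply/seteqP; split=> // p _; apply: contrapT => pN.
have only_X Y : H Y -> Y p -> Y = X.
  by move=> HY Yp; apply: contrapT => YX; apply: pN; exists Y.
apply: noP; exists p => //.
by have [Y HY Yp] := covering_pick p covH; rewrite -(only_X Y).
Qed.

(** A private point has no neighbours outside its only block; this recovers the
    blocks from the tolerance alone. *)
Lemma xsection_private H X p : H X -> X p ->
  (forall Y, H Y -> Y p -> Y = X) -> xsection (induced_tolerance H) p = X.
Proof.
move=> HX Xp only_X; apply/seteqP; split=> y.
  by move/xsectionP => -[Y HY [/= Yp Yy]]; rewrite -(only_X Y).
by move=> Xy; apply/xsectionP; exists X.
Qed.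

Lemma block_sub_xsection H X x : H X -> X x ->
  X `<=` xsection (induced_tolerance H) x.
Proof. by move=> HX Xx y Xy; apply/xsectionP; exists X. Qed.

Lemma irredundant_block_xsection H X : covering H -> irredundant H -> H X ->
  exists2 p, X p & xsection (induced_tolerance H) p = X.
Proof.
move=> covH irrH HX; have [p Xp only_X] := irredundant_private covH irrH HX.
by exists p => //; exact: xsection_private.
Qed.

(** The witness below [x] is a private point of any block [X] containing [x]:
    its neighbourhood is [X], and every point whose neighbourhood lies inside [X]
    belongs to [X], so its neighbourhood contains [X] too. *)
Lemma irredundant_bounded H : covering H -> irredundant H ->
  bounded_by_minimal (nbhd_le (induced_tolerance H)).
Proof.
move=> covH irrH x; have [X HX Xx] := covering_pick x covH.
have [p Xp secp] := irredundant_block_xsection covH irrH HX.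
exists p; split=> [y|]; rewrite /nbhd_le /= secp; last first.
  exact: block_sub_xsection.
move=> yX; apply: block_sub_xsection => //; apply: yX; apply/xsectionP.
by have [Y HY Yy] := covering_pick y covH; exists Y.
Qed.

Lemma irredundant_approx H : covering H -> irredundant H ->
  induced_tolerance H = nbhd_approx (induced_tolerance H).
Proof.
move=> covH irrH; apply/seteqP; split=> -[x y].
  move=> [X HX [/= Xx Xy]].
  have [p Xp secp] := irredundant_block_xsection covH irrH HX.
  apply/nbhd_approxE; exists p; rewrite /nbhd_le /= secp.
  by split; exact: block_sub_xsection.
move/nbhd_approxE => [a [ax ay]]; have [X HX Xa] := covering_pick a covH.
have [p Xp secp] := irredundant_block_xsection covH irrH HX.
have in_X z : nbhd_le (induced_tolerance H) (a, z) -> X z.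
  move=> /nbhd_leP az.
  have [|Y HY [/= Yz Yp]] := az p; first by exists X.
  by rewrite -secp; apply/xsectionP; exists Y.
by exists X => //; split; exact: in_X.
Qed.

(** The common lower bound of [m] and [x] is equivalent to [m] by minimality,
    so being a neighbour of [m] becomes lying above [m]. *)
Lemma minimal_le_neighbour R m x : R = nbhd_approx R ->
  minimal_elt (nbhd_le R) m -> R (m, x) -> nbhd_le R (m, x).
Proof.
move=> RE minm; rewrite {1}RE => /nbhd_approxE [a [am ax]].
exact: subset_trans (minm _ am) ax.
Qed.

Definition minimal_nbhds R : set (set U) :=
  xsection R @` minimal_elt (nbhd_le R).

Lemma minimal_nbhds_covering R : tolerance R ->
  bounded_by_minimal (nbhd_le R) -> covering (minimal_nbhds R).
Proof.
move=> [Rxx Rsym] bnd; split=> [_ [m _ <-]|]; first by exists m; apply/xsectionP.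
apply/seteqP; split=> // x _; have [m [minm /nbhd_leP mx]] := bnd x.
by exists (xsection R m); [exists m|apply/xsectionP/Rsym/mx].
Qed.

(** Each [m] is private to its neighbourhood: if [m] is a neighbour of another
    minimal point [n], each lies below the other, so both have the same
    neighbourhood. *)
Lemma minimal_nbhds_irredundant R : tolerance R -> R = nbhd_approx R ->
  irredundant (minimal_nbhds R).
Proof.
move=> [Rxx Rsym] RE _ [m minm <-] /(covering_pick m) [_ [[n minn <-] neq]].
move/xsectionP => Rnm; apply: neq; apply/seteqP.
by split; apply: minimal_le_neighbour => //; exact: Rsym.
Qed.

Lemma minimal_nbhds_induced R : tolerance R ->
  bounded_by_minimal (nbhd_le R) -> R = nbhd_approx R ->
  R = induced_tolerance (minimal_nbhds R).
Proof.
move=> [Rxx Rsym] bnd RE; apply/seteqP; split=> -[x y].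
  rewrite {1}RE => /nbhd_approxE [a [ax ay]]; have [m [minm ma]] := bnd a.
  have in_nbhd z : nbhd_le R (a, z) -> xsection R m z.
    by move=> /nbhd_leP az; apply/xsectionP/Rsym/az; move/nbhd_leP: ma; exact.
  by exists (xsection R m); [exists m|split; exact: in_nbhd].
move=> [_ [m minm <-] [/= /xsectionP mx /xsectionP my]].
rewrite RE; apply/nbhd_approxE; exists m.
by split; exact: minimal_le_neighbour.
Qed.

End IrredundantCoverings.

Theorem theorem3p4 (U : Type) (R : set (U * U)) (hR : tolerance R) :
  (exists H : set (set U),
     [/\ covering H, irredundant H & R = induced_tolerance H])
  <->
  (bounded_by_minimal (nbhd_le R) /\ R = nbhd_approx R).
Proof.
split=> [[H [covH irrH ->]]|[bnd RE]].
  by split; [exact: irredundant_bounded|exact: irredundant_approx].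
exists (minimal_nbhds R); split.
- exact: minimal_nbhds_covering.
- exact: minimal_nbhds_irredundant.
- exact: minimal_nbhds_induced.
Qed.
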